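(* Let $u(n,k)$ and $v(n,k)$ ($n\ge 0$, $k\ge 1$) be families of complex numbers, let $(a_n)_{n\ge 0}$ be a sequence of complex numbers, and define $(a_n^k)_{n,k\ge 0}$ by $a_n^0=a_n$ for $n\ge 0$ and $$a_n^k=u(n,k)\,a_n^{k-1}+v(n,k)\,a_{n+1}^{k-1}\qquad (n\ge 0,\ k\ge 1).$$ Then for all integers $n,k\ge 0$, $$a_n^k=\sum_{\ell=0}^{k} C_n(k,\ell)\,a_{n+\ell}^0,$$ where $$C_n(k,\ell)=\sum_{\substack{A\subset[k]\\ |A|=k-\ell}}\ \prod_{i=0}^{k-\ell-1} u(n+k-h_i-i,\,h_i)\ \prod_{j=0}^{\ell-1} v(n+j,\,m_j),$$ and, for each $A$, $h_0>h_1>\dots>h_{k-\ell-1}$ are the elements of $A$ in decreasing order and $m_0>m_1>\dots>m_{\ell-1}$ are the elements of $[k]\setminus A$ in decreasing order.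
   Context: $[k]=\{1,2,\dots,k\}$, with $[0]=\emptyset$. Superscripts in $a_n^k$ are indices (row $k$, column $n$), not powers. Empty products equal $1$. *)

(* Defs.v *)
From HB Require Import structures.
From mathcomp Require Import all_boot all_order all_algebra.
From mathcomp Require Import reals complex.

Set Implicit Arguments.
Unset Strict Implicit.
Unset Printing Implicit Defensive.

Import GRing.Theory.
Local Open Scope ring_scope.

(* [tableau u v a k n] is a_n^k (row [k], column [n]). The values [u n 0] and
   [v n 0] are never used, so [u] and [v] are effectively indexed by k >= 1. *)
Fixpoint tableau (R : realType) (u v : nat -> nat -> R[i]) (a : nat -> R[i])
    (k n : nat) : R[i] :=
  if k is k'.+1 then
    u n k * tableau u v a k' n + v n k * tableau u v a k' n.+1
  else a n.

(* [k] = {1, ..., k}, as a subset of {0, ..., k}. *)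
Definition segment (k : nat) : {set 'I_k.+1} := [set i : 'I_k.+1 | (0 < i)%N].

Definition decreasing_elements (k : nat) (A : {set 'I_k.+1}) : seq nat :=
  sort geq [seq val i | i in A].

(* C_n(k, l), meaningful for l <= k. The natural-number subtraction in the
   first argument of [u] does not truncate: h_i + i <= k, as h_i is the
   (i+1)-st largest element of a subset of [k]. *)
Definition table_coef (R : realType) (u v : nat -> nat -> R[i])
    (n k l : nat) : R[i] :=
  \sum_(A : {set 'I_k.+1} | (A \subset segment k) && (#|A| == k - l)%N)
    let h := nth 0%N (decreasing_elements A) in
    let m := nth 0%N (decreasing_elements (segment k :\: A)) in
    (\prod_(0 <= i < k - l) u (n + k - h i - i)%N (h i)) *
    (\prod_(0 <= j < l) v (n + j)%N (m j)).

(* Main.v *)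
Require Import Defs.
From mathcomp Require Import all_boot all_order all_algebra.
From mathcomp Require Import zify reals complex.

Set Implicit Arguments.
Unset Strict Implicit.
Unset Printing Implicit Defensive.

Import GRing.Theory.
Local Open Scope ring_scope.

(** Unfolding the recursion from level [k] down to level [1] gives a sum over
    the sets [A] of levels at which the [u]-branch is taken; the column moves
    only at the other levels. At level [h_i] the [k - h_i] levels above have
    been passed, [i] of them in [A], so the column is [n + k - h_i - i]; at
    level [m_j] it is [n + j]. Formally this is an induction on [k], splitting
    the subsets of [k+1] according to whether they contain [k+1]. *)

(** * Subsets of [[k]] inside subsets of [[k+1]] *)

Definition widen_set (k : nat) (A : {set 'I_k.+1}) : {set 'I_k.+2} :=
  widen_ord (leqnSn k.+1) @: A.

(** Since a preimage ignores [ord_max], this one map undoes both ways of extending a subset of [[k]]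
    to one of [[k+1]], with and without the new level. *)
Definition narrow_set (k : nat) (A : {set 'I_k.+2}) : {set 'I_k.+1} :=
  widen_ord (leqnSn k.+1) @^-1: A.

Lemma widen_ord_inj (k : nat) : injective (widen_ord (leqnSn k.+1)).
Proof. by move=> i j /(congr1 val) /= /val_inj. Qed.

Lemma ord_max_widen_set (k : nat) (A : {set 'I_k.+1}) :
  (ord_max \in widen_set A) = false.
Proof.
by apply/imsetP => -[i _ /(congr1 val) /= E]; have := ltn_ord i; lia.
Qed.

Lemma mem_widen_set (k : nat) (A : {set 'I_k.+1}) (i : 'I_k.+1) :
  (widen_ord (leqnSn k.+1) i \in widen_set A) = (i \in A).
Proof. exact/mem_imset/widen_ord_inj. Qed.

(** A case-analysis view: set equalities at level [k+1] are checked once at the new top element and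
    once on the old ones. *)
Variant ord_max_spec (k : nat) : 'I_k.+2 -> Type :=
  | IsMax : ord_max_spec ord_max
  | IsWiden (i : 'I_k.+1) : ord_max_spec (widen_ord (leqnSn k.+1) i).

Lemma ord_maxP (k : nat) (i : 'I_k.+2) : ord_max_spec i.
Proof.
case: (ltnP i k.+1) => [lt_ik | le_ki].
  suff -> : i = widen_ord (leqnSn k.+1) (Ordinal lt_ik) by constructor.
  exact: val_inj.
suff -> : i = ord_max by constructor.
by apply: val_inj => /=; have := ltn_ord i; lia.
Qed.

Lemma widen_ord_max (k : nat) (i : 'I_k.+1) :
  (widen_ord (leqnSn k.+1) i == ord_max) = false.
Proof. by apply/negbTE/eqP => /(congr1 val) /= E; have := ltn_ord i; lia. Qed.

Lemma widen_setK (k : nat) : cancel (@widen_set k) (@narrow_set k).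
Proof. by move=> A; apply/setP => i; rewrite inE mem_widen_set. Qed.

Lemma setU1_widen_setK (k : nat) (A : {set 'I_k.+1}) :
  narrow_set (ord_max |: widen_set A) = A.
Proof. by apply/setP => i; rewrite !inE mem_widen_set widen_ord_max. Qed.

Lemma narrow_setK (k : nat) (A : {set 'I_k.+2}) :
  ord_max \notin A -> widen_set (narrow_set A) = A.
Proof.
move=> /negbTE maxA; apply/setP => i; case: (ord_maxP i) => [|j].
  by rewrite ord_max_widen_set maxA.
by rewrite mem_widen_set inE.
Qed.

Lemma setU1_narrow_setK (k : nat) (A : {set 'I_k.+2}) :
  ord_max \in A -> ord_max |: widen_set (narrow_set A) = A.
Proof.
move=> maxA; apply/setP => i; case: (ord_maxP i) => [|j].
  by rewrite !inE eqxx maxA.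
by rewrite in_setU1 mem_widen_set inE widen_ord_max.
Qed.

Lemma widen_set_sub_segment (k : nat) (A : {set 'I_k.+1}) :
  (widen_set A \subset segment k.+1) = (A \subset segment k).
Proof.
apply/subsetP/subsetP => sub i.
  by rewrite -mem_widen_set => /sub; rewrite !inE.
by case/imsetP => j /sub; rewrite !inE => lt0j ->.
Qed.

Lemma setU1_widen_set_sub_segment (k : nat) (A : {set 'I_k.+1}) :
  (ord_max |: widen_set A \subset segment k.+1) = (A \subset segment k).
Proof. by rewrite subUset sub1set inE widen_set_sub_segment. Qed.

Lemma segmentD_widen_set (k : nat) (A : {set 'I_k.+1}) :
  segment k.+1 :\: widen_set A = ord_max |: widen_set (segment k :\: A).
Proof.
apply/setP => i; case: (ord_maxP i) => [|j].
  by rewrite !inE ord_max_widen_set eqxx.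
by rewrite in_setD in_setU1 !mem_widen_set !inE widen_ord_max.
Qed.

Lemma segmentD_setU1_widen_set (k : nat) (A : {set 'I_k.+1}) :
  segment k.+1 :\: (ord_max |: widen_set A) = widen_set (segment k :\: A).
Proof.
apply/setP => i; case: (ord_maxP i) => [|j].
  by rewrite !inE !ord_max_widen_set eqxx.
by rewrite in_setD in_setU1 !mem_widen_set !inE widen_ord_max.
Qed.

(** * Decreasing enumerations *)

Lemma size_decreasing_elements (k : nat) (A : {set 'I_k.+1}) :
  size (decreasing_elements A) = #|A|.
Proof. by rewrite size_sort size_map cardE. Qed.

Lemma decreasing_elements_sorted (k : nat) (A : {set 'I_k.+1}) :
  sorted geq (decreasing_elements A).
Proof. by apply: sort_sorted => x y; rewrite /geq /= leq_total. Qed.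

Lemma decreasing_elements_uniq (k : nat) (A : {set 'I_k.+1}) :
  uniq (decreasing_elements A).
Proof. by rewrite sort_uniq map_inj_uniq ?enum_uniq //; exact: val_inj. Qed.

Lemma mem_decreasing_elements (k : nat) (A : {set 'I_k.+1}) (x : nat) :
  reflect (exists2 i, i \in A & x = val i) (x \in decreasing_elements A).
Proof.
rewrite mem_sort; apply: (iffP mapP) => -[i iA ->]; exists i => //.
  by rewrite mem_enum in iA.
by rewrite mem_enum.
Qed.

(** Antisymmetry of the order leaves only one sorted arrangement, so identities between decreasing
    enumerations reduce to membership. *)
Lemma geq_sorted_uniq_eq (s t : seq nat) :
  sorted geq s -> sorted geq t -> uniq s -> uniq t -> s =i t -> s = t.
Proof.
move=> ss st us ut st_eq; apply: (@sorted_eq _ geq) => //.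
- by move=> y x z /= le_yx le_zy; exact: leq_trans le_zy le_yx.
- by move=> x y /=; rewrite andbC -eqn_leq => /eqP.
- exact: uniq_perm.
Qed.

Lemma decreasing_elements_widen_set (k : nat) (A : {set 'I_k.+1}) :
  decreasing_elements (widen_set A) = decreasing_elements A.
Proof.
apply: geq_sorted_uniq_eq;
  rewrite ?decreasing_elements_sorted ?decreasing_elements_uniq //.
move=> x.
apply/mem_decreasing_elements/mem_decreasing_elements => [[j]|[i iA ->]].
  by case/imsetP => i iA -> ->; exists i.
by exists (widen_ord (leqnSn k.+1) i); rewrite ?mem_widen_set.
Qed.

(** The new level exceeds all old ones, so it comes first and shifts every other index by one. *)
Lemma decreasing_elements_setU1_widen_set (k : nat) (A : {set 'I_k.+1}) :
  decreasing_elements (ord_max |: widen_set A) =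
  k.+1 :: decreasing_elements A.
Proof.
have ltk x : x \in decreasing_elements A -> (x < k.+1)%N.
  by case/mem_decreasing_elements => j _ ->; exact: ltn_ord.
apply: geq_sorted_uniq_eq;
  rewrite ?decreasing_elements_sorted ?decreasing_elements_uniq //.
- rewrite /= path_min_sorted ?decreasing_elements_sorted //.
  by apply/allP => x /ltk /ltnW.
- rewrite /= decreasing_elements_uniq andbT.
  by apply/negP => /ltk; rewrite ltnn.
move=> x; rewrite in_cons -(decreasing_elements_widen_set A).
apply/mem_decreasing_elements/orP => [[j] | [/eqP -> | ]].
- rewrite in_setU1 => /orP[/eqP -> -> | jA ->]; first by left.
  by right; apply/mem_decreasing_elements; exists j.
- by exists ord_max; rewrite // in_setU1 eqxx.
case/mem_decreasing_elements => i iA ->; exists i => //.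
by rewrite in_setU1 iA orbT.
Qed.

Lemma big_subset_segmentS (V : nmodType) (k : nat) (F : {set 'I_k.+2} -> V) :
  \sum_(A : {set 'I_k.+2} | A \subset segment k.+1) F A =
  \sum_(A : {set 'I_k.+1} | A \subset segment k) F (ord_max |: widen_set A) +
  \sum_(A : {set 'I_k.+1} | A \subset segment k) F (widen_set A).
Proof.
rewrite (bigID (fun A : {set 'I_k.+2} => ord_max \in A)) /=; congr (_ + _).
  (* Subsets containing [k+1] correspond to subsets of [[k]] by deleting [k+1]; the others are
     handled below by plain restriction. *)
  rewrite (reindex_onto (fun A : {set 'I_k.+1} => ord_max |: widen_set A)
                        (@narrow_set k)) /=; last first.
    by move=> A /andP[_]; exact: setU1_narrow_setK.
  apply: eq_bigl => A; rewrite setU1_widen_setK setU1_widen_set_sub_segment.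
  by rewrite in_setU1 !eqxx !andbT.
rewrite (reindex_onto (@widen_set k) (@narrow_set k)) /=; last first.
  by move=> A /andP[_]; exact: narrow_setK.
apply: eq_bigl => A; rewrite widen_setK widen_set_sub_segment.
by rewrite ord_max_widen_set eqxx !andbT.
Qed.

(** * Weights of paths through the recursion *)

Section PathWeight.
Variables (R : realType) (u v : nat -> nat -> R[i]).

(** Taking lists instead of a set makes one step of the recursion a cons on [h] or on [m]. *)
Definition path_weight (n k : nat) (h m : seq nat) : R[i] :=
  (\prod_(0 <= i < size h) u (n + k - nth 0 h i - i)%N (nth 0%N h i)) *
  (\prod_(0 <= j < size m) v (n + j)%N (nth 0%N m j)).

(** The head contributes the column [n + k.+1 - k.+1 - 0 = n]. In the other factors the increase of
    [k] cancels the shift of [i], also under truncated subtraction. *)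
Lemma path_weight_u (n k : nat) (h m : seq nat) :
  path_weight n k.+1 (k.+1 :: h) m = u n k.+1 * path_weight n k h m.
Proof.
rewrite /path_weight /= big_nat_recl //= mulrA subn0 addnK.
congr (_ * _ * _); apply: eq_bigr => i _; congr (u _ _); lia.
Qed.

(** Passing to column [n.+1] absorbs both the increase of [k] in the [u]-factors and the shift of
    [j] in the [v]-factors. *)
Lemma path_weight_v (n k : nat) (h m : seq nat) :
  path_weight n k.+1 h (k.+1 :: m) = v n k.+1 * path_weight n.+1 k h m.
Proof.
rewrite /path_weight /= big_nat_recl //= addn0 mulrCA addSnnS.
by congr (_ * (_ * _)); apply: eq_bigr => j _; rewrite addSnnS.
Qed.

(** Leaving the subsets ungrouped by size keeps [l] out of the induction; the final column counts
    the levels where the [v]-branch is taken. *)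
Lemma tableau_path_sum (a : nat -> R[i]) (n k : nat) :
  tableau u v a k n =
  \sum_(A : {set 'I_k.+1} | A \subset segment k)
    path_weight n k (decreasing_elements A)
                    (decreasing_elements (segment k :\: A)) *
    a (n + #|segment k :\: A|)%N.
Proof.
elim: k n => [|k IHk] n.
  have seg0 : segment 0 = set0 by apply/setP => i; rewrite !inE (ord1 i).
  rewrite (big_pred1 set0) => [|A]; last by rewrite seg0 subset0.
  rewrite seg0 set0D /path_weight !size_decreasing_elements cards0.
  by rewrite !big_geq // !mul1r addn0.
(* The hypothesis is used in columns [n] and [n.+1]: sets containing [k+1] match the [u]-branch, the
   others the [v]-branch. *)
rewrite big_subset_segmentS /= !IHk !big_distrr /=.
congr (_ + _); apply: eq_bigr => A _.
  rewrite segmentD_setU1_widen_set decreasing_elements_setU1_widen_set.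
  rewrite decreasing_elements_widen_set path_weight_u mulrA.
  by rewrite card_imset //; exact: widen_ord_inj.
rewrite segmentD_widen_set decreasing_elements_setU1_widen_set.
rewrite decreasing_elements_widen_set path_weight_v mulrA.
(* The complement gains [k+1], which accounts for the step from [n] to [n.+1]. *)
rewrite cardsU1 ord_max_widen_set card_imset ?addnA ?addn1 //.
exact: widen_ord_inj.
Qed.

End PathWeight.

(** * Grouping the subsets by cardinality *)

Lemma card_segment (k : nat) : #|segment k| = k.
Proof.
have -> : segment k = [set~ ord0].
  by apply/setP => i; rewrite !inE lt0n.
by rewrite cardsC1 card_ord.
Qed.

Lemma card_sub_segment (k : nat) (A : {set 'I_k.+1}) :
  A \subset segment k -> (#|A| <= k)%N.
Proof. by move/subset_leq_card; rewrite card_segment. Qed.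

Theorem theorem9 (R : realType) (u v : nat -> nat -> R[i]) (a : nat -> R[i])
    (n k : nat) :
  tableau u v a k n =
  \sum_(0 <= l < k.+1) table_coef u v n k l * tableau u v a 0 (n + l)%N.
Proof.
rewrite tableau_path_sum big_mkord.
(* The class of [A] is [l = k - #|A|], the size of its complement; [inord] returns this value
   unchanged because it is at most [k]. *)
rewrite (partition_big (fun A : {set 'I_k.+1} => inord (k - #|A|) : 'I_k.+1)
                       xpredT) //=.
apply: eq_bigr => l _; rewrite /table_coef big_distrl /=.
have le_lk : (l <= k)%N by rewrite -ltnS.
apply: eq_big => [A | A /andP[subA /eqP El]].
  case subA: (A \subset segment k) => //=.
  have leA := card_sub_segment subA.
  rewrite -val_eqE /= inordK ?ltnS ?leq_subr //.
  by apply/eqP/eqP => [<-|->]; rewrite subKn.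
have leA := card_sub_segment subA.
have lA : (k - #|A|)%N = l by rewrite -El inordK // ltnS leq_subr.
have cardDA : #|segment k :\: A| = l.
  by rewrite cardsD (setIidPr subA) card_segment.
(* Both weights now differ only in the bounds of their products: list sizes against [k - l] and
   [l]. *)
rewrite cardDA /path_weight !size_decreasing_elements cardDA.
by have -> : (k - l)%N = #|A| by rewrite -lA subKn.
Qed.
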